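(* Fix an integer $t\ge 2$ and a real base $b>1$, and let $\log$ and $\exp$ denote the logarithm and exponential to base $b$. For an integer $p\ge 1$, let $T_t(p)$ denote the number of $t$-ary trees whose path length equals $p$. Let $h(x)=-x\log x-(1-x)\log(1-x)$ be the binary entropy function and set $\alpha=h(t^{-1})\,t\log t$. Then, as $p\to\infty$, \[ T_t(p)=\exp\!\Big(\frac{\alpha p}{\log p}\,\big(1+o(1)\big)\Big), \] i.e. $\log T_t(p)\big/\big(\alpha p/\log p\big)\to 1$ as $p\to\infty$.
   Context: A $t$-ary tree is defined recursively as either empty or consisting of a root node together with an ordered $t$-tuple $(T_1,\dots,T_t)$ of disjoint $t$-ary subtrees, any of which may be empty; when $T_i$ is non-empty its root is a child of the root. Thus $t$-ary trees are ordered (plane) trees in which each node has $t$ labeled child positions, and two trees differ if a child occupies a different position. The depth of a node is the number of edges on the path from the root to it. The path length of a non-empty $t$-ary tree is the sum of the depths of all its nodes, i.e. $\sum_{j\ge1} j D_j$ where $D_j$ is the number of nodes at depth $j$. Only finite trees are considered; the number of nodes is not fixed in $T_t(p)$. *)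

(* Defs.v *)
From mathcomp Require Import all_boot.
From Stdlib Require Import Reals List ClassicalEpsilon.

Set Implicit Arguments.
Unset Strict Implicit.
Unset Printing Implicit Defensive.

Inductive ttree (t : nat) : Type :=
  | TEmpty : ttree t
  | TNode : {ffun 'I_t -> ttree t} -> ttree t.

Arguments TEmpty {t}.

Fixpoint tsize (t : nat) (T : ttree t) : nat :=
  match T with
  | TEmpty => 0
  | TNode f => (sumn (codom (fun i => tsize (f i)))).+1
  end.

(* path length = sum over nodes of their depth.  Each node of subtree T_i
   has depth one more in T than in T_i, hence the recursion. *)
Fixpoint tpathlen (t : nat) (T : ttree t) : nat :=
  match T with
  | TEmpty => 0
  | TNode f => sumn (codom (fun i => tpathlen (f i) + tsize (f i)))
  end.

Definition is_count (t p n : nat) : Prop :=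
  exists l : list (ttree t),
    NoDup l /\ (forall x, In x l <-> (x <> TEmpty /\ tpathlen x = p)) /\ length l = n.

(* T_t(p): the number of (non-empty) t-ary trees with path length p
   (this set is finite, so is_count t p has a (unique) witness). *)
Definition Tcount (t p : nat) : nat := epsilon (inhabits 0%nat) (is_count t p).

Open Scope R_scope.

Definition logb (b x : R) : R := ln x / ln b.

Definition hent (b x : R) : R := - x * logb b x - (1 - x) * logb b (1 - x).

Definition alpha (b : R) (t : nat) : R :=
  hent b (/ INR t) * INR t * logb b (INR t).

(* Main.v *)
(** For a critical weight z per node, the generating function of t-ary trees
    of bounded height satisfies F_{d+1} = 1 + z F_d^t, which stays below
    t/(t-1) when 1/z = t^t/(t-1)^(t-1) and is unbounded for any larger z.
    Hence the number of trees with n nodes grows like exp (c n), where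
    c = ln (t^t/(t-1)^(t-1)), and alpha = c ln t up to the change of base.

    Upper bound: as there are at most t^j nodes at depth j, a tree with path
    length p has at most (p + 2 t^k)/k nodes for every k; taking t^k close to
    p / ln p leaves (1 + o(1)) p ln t / ln p nodes.

    Lower bound: below a complete t-ary tree of height D, each of the t^D slots
    receives one of exp ((1 - o(1)) c m) trees with m nodes, where m is of
    order sqrt (ln p) and the path length (1 + o(1)) t^D m D is at most p.
    Such a tree becomes the first child of a new root, whose second child is a
    padding tree that brings the path length to exactly p. *)
From HB Require Import structures.
From Stdlib Require Import Reals Lra List Permutation ClassicalEpsilon.
From mathcomp Require Import all_boot zify.
Require Import Defs.

Set Implicit Arguments.
Unset Strict Implicit.
Unset Printing Implicit Defensive.
Local Open Scope nat_scope.

(** * Size against path length *)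

Lemma ttree_induction (t : nat) (P : ttree t -> Prop) :
  P TEmpty ->
  (forall f : {ffun 'I_t -> ttree t}, (forall i, P (f i)) -> P (TNode f)) ->
  forall T, P T.
Proof.
move=> P0 PN; fix IH 1; case=> [|f]; first exact: P0.
by apply: PN => i; apply: IH.
Qed.

Lemma tsize_node t (f : {ffun 'I_t -> ttree t}) :
  tsize (TNode f) = (\sum_i tsize (f i)).+1.
Proof. by rewrite /= sumnE codomE big_map big_enum. Qed.

Lemma tpathlen_node t (f : {ffun 'I_t -> ttree t}) :
  tpathlen (TNode f) = \sum_i (tpathlen (f i) + tsize (f i)).
Proof. by rewrite /= sumnE codomE big_map big_enum. Qed.

Lemma tsize_le_pathlen t (T : ttree t) : tsize T <= (tpathlen T).+1.
Proof.
case: T => [|f] //; rewrite tsize_node tpathlen_node ltnS.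
by apply: leq_sum => i _; apply: leq_addl.
Qed.

Lemma leq_sum_sqr (I : finType) (F : I -> nat) :
  \sum_i F i ^ 2 <= (\sum_i F i) ^ 2.
Proof.
rewrite -[X in _ <= X]mulnn big_distrl /=; apply: leq_sum => i _.
by rewrite -mulnn leq_mul2l (bigD1 i) //= leq_addr orbT.
Qed.

(** A crude bound that suffices for the slot trees of the lower bound, whose size is small compared
    with the height of the complete tree above them. *)
Lemma tpathlen_le_sqr t (T : ttree t) : tpathlen T <= tsize T ^ 2.
Proof.
elim/ttree_induction: T => [|f IH] //.
rewrite tsize_node tpathlen_node big_split /=.
have H : \sum_i tpathlen (f i) <= (\sum_i tsize (f i)) ^ 2.
  by apply: leq_trans (leq_sum_sqr _); apply: leq_sum => i _.
move: H; set P := \sum_i _; set S := \sum_i _ => H.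
by rewrite -addn1 sqrnD muln1; move: H; lia.
Qed.

(* The sum of (k - j) * t ^ j over j < k. *)
Fixpoint defect (t k : nat) : nat :=
  if k is k'.+1 then t * defect t k' + k'.+1 else 0.

(** The term [k + 2] closes the induction: the left side becomes [t * defect t k + 2 * (k + 2)], at
    most [t] times the previous one. *)
Lemma defect_le t k : 2 <= t -> defect t k + k + 2 <= 2 * t ^ k.
Proof.
move=> ht; elim: k => [|k IH] //=; rewrite expnS.
nia.
Qed.

(** For a node at depth [j], [k] is at most [j] plus the truncated [k - j], and at most [t ^ j]
    nodes have depth [j]. The induction lowers [k] by one in the subtrees, as depths do. *)
Lemma tsize_le_defect t (T : ttree t) k :
  k * tsize T <= tpathlen T + defect t k.
Proof.
elim/ttree_induction: T k => [|f IH] [|k] //; first by rewrite muln0.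
rewrite tsize_node tpathlen_node /= mulnS addnC addnA leq_add2r.
have <- : \sum_(i < t) defect t k = t * defect t k by rewrite sum_nat_const card_ord.
rewrite big_distrr -big_split /=; apply: leq_sum => i _.
by move: (IH i k); lia.
Qed.

Lemma mul_tsize_le t (T : ttree t) k : 2 <= t ->
  k * tsize T <= tpathlen T + 2 * t ^ k.
Proof.
by move=> ht; move: (tsize_le_defect T k) (defect_le k ht); lia.
Qed.

(** * Trees of bounded height as finite types *)

Section BoundedHeight.
Variable t : nat.

(** A [finType], so that sums and cardinals over trees make sense; [d] bounds the number of levels
    of nodes and [inl] is the empty tree. *)
Fixpoint htree (d : nat) : finType :=
  if d is d'.+1 then (unit + {ffun 'I_t -> htree d'})%type else unit.

Fixpoint emb (d : nat) : htree d -> ttree t :=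
  if d is d'.+1 then
    fun x => match x with
             | inl _ => TEmpty
             | inr f => TNode [ffun i => emb (f i)]
             end
  else fun _ => TEmpty.

Lemma emb_inj d : injective (@emb d).
Proof.
elim: d => [[] []|d IH] //= [[]|f] [[]|g] //= [E]; congr inr.
by apply/ffunP => i; apply: IH; move/ffunP/(_ i): E; rewrite !ffunE.
Qed.

Lemma emb_surj (T : ttree t) d : tsize T <= d -> exists x : htree d, emb x = T.
Proof.
elim/ttree_induction: T d => [|f IH] [|d] //; first by exists tt.
  by exists (inl tt).
rewrite tsize_node ltnS => le_d.
have /fin_all_exists [g Hg] i : exists x : htree d, emb x = f i.
  by apply: IH; apply: leq_trans le_d; rewrite (bigD1 i) //= leq_addr.
by exists (inr [ffun i => g i]) => /=; congr TNode; apply/ffunP => i; rewrite !ffunE.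
Qed.

Definition has_pathlen p (T : ttree t) : bool :=
  (0 < tsize T) && (tpathlen T == p).

Lemma has_pathlenP p T : reflect (T <> TEmpty /\ tpathlen T = p) (has_pathlen p T).
Proof.
apply: (iffP andP) => -[].
  by move=> s_gt0 /eqP ->; split=> // T0; rewrite T0 in s_gt0.
by case: T => [|f] // _ /eqP.
Qed.

Lemma NoDup_map_enum (X : finType) (A : pred X) (U : Type) (f : X -> U) :
  injective f -> NoDup (List.map f (enum A)).
Proof.
move=> f_inj; apply: FinFun.Injective_map_NoDup => //.
elim: (enum A) (enum_uniq A) => [|x s IH] /=; first by constructor.
case/andP=> xs us; constructor; last exact: IH.
by move=> xs'; case/negP: xs; elim: s {us IH} xs' => //= y s IH [->|/IH];
  rewrite inE ?eqxx // orbC => ->.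
Qed.

Lemma In_mem (X : eqType) (s : seq X) x : In x s <-> x \in s.
Proof.
elim: s => [|y s IH] //=; rewrite inE; split.
  by case=> [->|/IH ->]; rewrite ?eqxx ?orbT.
by case/orP=> [/eqP ->|/IH]; [left|right].
Qed.

(** Level [p.+1] captures every tree of path length [p]: it has at most [p + 1] nodes, and no more
    levels than nodes. *)
Lemma is_count_card p :
  is_count t p #|[pred x : htree p.+1 | has_pathlen p (emb x)]|.
Proof.
set A := [pred x | _].
exists (List.map (@emb _) (enum A)); split; last split.
- exact/NoDup_map_enum/emb_inj.
- move=> T; split=> [/in_map_iff [x [<- /In_mem]]|].
    by rewrite mem_enum => /has_pathlenP.
  move/has_pathlenP => HT; have /andP[_ /eqP pT] := HT.
  have [|x xT] := @emb_surj T p.+1; first by rewrite -pT tsize_le_pathlen.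
  apply/in_map_iff; exists x; split=> //.
  by apply/In_mem; rewrite mem_enum inE xT.
- by rewrite List.length_map cardE.
Qed.

(** [epsilon] yields some witness of [is_count], and witnesses agree: duplicate-free lists with the
    same elements are permutations of each other. *)
Lemma TcountE p : Tcount t p = #|[pred x : htree p.+1 | has_pathlen p (emb x)]|.
Proof.
have cA := is_count_card p.
have /= := epsilon_spec (inhabits 0) _ (ex_intro _ _ cA).
rewrite -/(Tcount t p) => -[l [lu [lP <-]]].
case: cA => l' [lu' [lP' <-]]; apply: Permutation_length.
by apply: NoDup_Permutation => // T; rewrite lP lP'.
Qed.

Lemma Tcount_ge (X : finType) (f : X -> ttree t) p : injective f ->
  (forall x, has_pathlen p (f x)) -> #|X| <= Tcount t p.
Proof.
move=> f_inj fp; rewrite TcountE.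
have /fin_all_exists [g Hg] x : exists y : htree p.+1, emb y = f x.
  by apply: emb_surj; case/andP: (fp x) => _ /eqP <-; apply: tsize_le_pathlen.
have g_inj : injective g by move=> x y E; apply: f_inj; rewrite -!Hg E.
rewrite -(card_codom g_inj); apply: subset_leq_card; apply/subsetP => _ /codomP[x ->].
by rewrite inE Hg.
Qed.

End BoundedHeight.

Local Open Scope R_scope.

(** * Real sums and products as big operators *)

Fact Rplus_A : associative Rplus. Proof. by move=> x y z; ring. Qed.
Fact Rplus_C : commutative Rplus. Proof. by move=> x y; ring. Qed.
Fact Rplus_0 : left_id 0 Rplus. Proof. by move=> x; ring. Qed.
Fact Rmult_A : associative Rmult. Proof. by move=> x y z; ring. Qed.
Fact Rmult_C : commutative Rmult. Proof. by move=> x y; ring. Qed.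
Fact Rmult_1 : left_id 1 Rmult. Proof. by move=> x; ring. Qed.
Fact Rmult_0l : left_zero 0 Rmult. Proof. by move=> x; ring. Qed.
Fact Rmult_0r : right_zero 0 Rmult. Proof. by move=> x; ring. Qed.
Fact Rmult_Dl : left_distributive Rmult Rplus. Proof. by move=> x y z; ring. Qed.
Fact Rmult_Dr : right_distributive Rmult Rplus. Proof. by move=> x y z; ring. Qed.

HB.instance Definition _ := Monoid.isComLaw.Build R 0 Rplus Rplus_A Rplus_C Rplus_0.
HB.instance Definition _ := Monoid.isComLaw.Build R 1 Rmult Rmult_A Rmult_C Rmult_1.
HB.instance Definition _ := Monoid.isMulLaw.Build R 0 Rmult Rmult_0l Rmult_0r.
HB.instance Definition _ := Monoid.isAddLaw.Build R Rmult Rplus Rmult_Dl Rmult_Dr.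

Lemma rsum_le (I : Type) (s : seq I) (P : pred I) (F G : I -> R) :
  (forall i, P i -> F i <= G i) ->
  \big[Rplus/0]_(i <- s | P i) F i <= \big[Rplus/0]_(i <- s | P i) G i.
Proof.
move=> FG; elim/big_rec2: _ => [|i x y Pi xy]; first lra.
by have := FG i Pi; lra.
Qed.

Lemma rsum_ge0 (I : Type) (s : seq I) (P : pred I) (F : I -> R) :
  (forall i, P i -> 0 <= F i) -> 0 <= \big[Rplus/0]_(i <- s | P i) F i.
Proof.
move=> F0; elim/big_rec: _ => [|i x Pi x0]; first lra.
by have := F0 i Pi; lra.
Qed.

Lemma rsum_const (I : finType) (P : pred I) (a : R) :
  \big[Rplus/0]_(i | P i) a = INR #|P| * a.
Proof.
rewrite big_const; elim: #|P| => [|n IH]; first by rewrite /=; lra.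
by rewrite iterS IH S_INR; lra.
Qed.

Lemma rsum_geom (r : R) n : 0 <= r < 1 ->
  \big[Rplus/0]_(i < n) r ^ i <= / (1 - r).
Proof.
move=> r01.
have -> : \big[Rplus/0]_(i < n) r ^ i = (1 - r ^ n) / (1 - r).
  elim: n => [|n IH]; first by rewrite big_ord0 /=; field; lra.
  by rewrite big_ord_recr IH /=; field; lra.
have := pow_le r n; have : 0 < / (1 - r) by apply: Rinv_0_lt_compat; lra.
rewrite /Rdiv; nra.
Qed.

Lemma rprod_const (n : nat) (a : R) : \big[Rmult/1]_(i < n) a = a ^ n.
Proof. by elim: n => [|n IH]; rewrite ?big_ord0 // big_ord_recl IH. Qed.

Lemma rprod_pow (n : nat) (z : R) (F : 'I_n -> nat) :
  \big[Rmult/1]_(i < n) z ^ F i = z ^ (\sum_i F i).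
Proof.
by elim/big_rec2: _ => //= i m x _ ->; rewrite -pow_add.
Qed.

Lemma bernoulli_ge0 (u : R) n : 0 <= u -> 1 + INR n * (u - 1) <= u ^ n.
Proof.
move=> u0; elim: n => [|n IH]; first by rewrite /=; lra.
have := Rmult_le_pos _ _ (pos_INR n) (Rle_0_sqr (u - 1)).
have := Rmult_le_compat_l u _ _ u0 IH.
by rewrite S_INR /Rsqr -tech_pow_Rmult; lra.
Qed.

(** * The generating function by height and the growth rate of trees *)

Section GeneratingFunction.
Variables (t : nat) (ht : (2 <= t)%N).

Let INRt : 2 <= INR t.
Proof. by apply: (le_INR 2); apply/leP. Qed.

Definition gf (z : R) (d : nat) : R :=
  \big[Rplus/0]_(x : htree t d) z ^ tsize (emb x).

Lemma tsize_emb_node d (f : {ffun 'I_t -> htree t d}) :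
  tsize (@emb t d.+1 (inr f)) = (\sum_i tsize (emb (f i))).+1.
Proof.
by rewrite [LHS]tsize_node; congr _.+1; apply: eq_bigr => i _; rewrite ffunE.
Qed.

(** By distributivity the [t]-th power is a sum over [t]-tuples of subtrees; the factor [z] is the
    root. *)
Lemma gfS z d : gf z d.+1 = 1 + z * gf z d ^ t.
Proof.
rewrite /gf big_sumType; congr (_ + _).
  by rewrite (big_pred1 tt) => // -[].
rewrite -rprod_const bigA_distr_bigA big_distrr; apply: eq_bigr => f _.
by rewrite tsize_emb_node rprod_pow.
Qed.

(** The exponential growth rate of the Fuss-Catalan numbers, which count [t]-ary trees by nodes; its
    inverse is the critical weight. *)
Definition growth : R := INR t ^ t / (INR t - 1) ^ t.-1.

Lemma growth_gt0 : 0 < growth.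
Proof. by apply: Rdiv_lt_0_compat; apply: pow_lt; lra. Qed.

Lemma gf0 z : gf z 0 = 1.
Proof. by rewrite /gf (big_pred1 tt) //; case. Qed.

(** The substitution [y = t / (t - 1) u] moves the double root to [u = 1]. *)
Lemma gf_growth_scale u : u ^ t / (INR t - 1) = / growth * (INR t / (INR t - 1) * u) ^ t.
Proof.
rewrite /growth /Rdiv !Rpow_mult_distr pow_inv.
have -> : (INR t - 1) ^ t = (INR t - 1) * (INR t - 1) ^ t.-1.
  by rewrite tech_pow_Rmult prednK // ltnW.
by field; do ?split; try apply: pow_nonzero; lra.
Qed.

(* t/(t-1) is the double root of y = 1 + z y^t at the critical z = 1/growth. *)
Lemma gf_growth_le d : gf (/ growth) d <= INR t / (INR t - 1).
Proof.
have tE : INR t / (INR t - 1) = 1 + 1 / (INR t - 1) by field; lra.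
have invt : 0 < / (INR t - 1) by apply: Rinv_0_lt_compat; lra.
elim: d => [|d IH]; first by rewrite gf0 tE; lra.
rewrite gfS {}tE; apply: Rplus_le_compat_l.
have := gf_growth_scale 1; rewrite pow1 Rmult_1_r => ->.
apply: Rmult_le_compat_l; first by apply/Rlt_le/Rinv_0_lt_compat/growth_gt0.
apply: pow_incr; split=> //; apply: rsum_ge0 => x _.
by apply: pow_le; apply/Rlt_le/Rinv_0_lt_compat/growth_gt0.
Qed.

Lemma gf_growth_le2 d : gf (/ growth) d <= 2.
Proof.
apply: Rle_trans (gf_growth_le d) _.
by apply: (Rmult_le_reg_r (INR t - 1)); first lra; field_simplify; lra.
Qed.

(** At the critical weight the convex curve [1 + z y ^ t] touches the diagonal from above; after
    rescaling this is Bernoulli's inequality. *)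
Lemma gf_step y : 0 <= y -> y <= 1 + / growth * y ^ t.
Proof.
move=> y0; set u := y * (INR t - 1) / INR t.
have -> : y = INR t / (INR t - 1) * u by rewrite /u; field; lra.
rewrite -gf_growth_scale.
have u0 : 0 <= u.
  by apply: Rmult_le_pos; [nra | apply/Rlt_le/Rinv_0_lt_compat; lra].
have := bernoulli_ge0 t u0 => B.
apply: (Rmult_le_reg_r (INR t - 1)); first lra.
by field_simplify; lra.
Qed.

(** Each level gains at least the excess of [z] over the critical weight, since [gf z d] stays at
    least 1. *)
Lemma gf_ge z d : / growth <= z -> 1 + INR d * (z - / growth) <= gf z d.
Proof.
move=> zg; elim: d => [|d IH]; first by rewrite gf0 /=; lra.
have g1 : 1 <= gf z d by have := pos_INR d; nra.
rewrite gfS; have := gf_step (y := gf z d) ltac:(lra).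
have := pow_R1_Rle (gf z d) t g1; rewrite S_INR; nra.
Qed.

Lemma rsum_tsize_geom (c z : R) n0 d : 0 <= z -> exp c * z < 1 ->
  (forall n, (n0 <= n)%N ->
     INR #|[pred x : htree t d | tsize (emb x) == n]| <= exp c ^ n) ->
  \big[Rplus/0]_(x : htree t d | (n0 <= tsize (emb x))%N) z ^ tsize (emb x)
    <= / (1 - exp c * z).
Proof.
move=> z0 cz few; have ec := exp_pos c.
(* A bound on all sizes at this height, so that trees can be grouped by size over the finite type
   ['I_N.+1]. *)
pose N := \max_(x : htree t d) tsize (emb x).
have szE (x : htree t d) : nat_of_ord (inord (tsize (emb x)) : 'I_N.+1) = tsize (emb x).
  by rewrite inordK // ltnS /N (bigD1 x) //= leq_maxl.
rewrite (partition_big (fun x => inord (tsize (emb x)) : 'I_N.+1) predT) //.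
apply: Rle_trans (rsum_geom N.+1 (conj (Rmult_le_pos _ _ (Rlt_le _ _ ec) z0) cz)).
apply: rsum_le => j _.
have [n0j|jn0] := leqP n0 j.
  apply: (Rle_trans _ (INR #|[pred x : htree t d | tsize (emb x) == j]| * z ^ j)).
    rewrite -rsum_const big_mkcond [X in _ <= X]big_mkcond.
    apply: rsum_le => x _ /=; rewrite -val_eqE /= szE.
    have := pow_le z (tsize (emb x)) z0; have [->|_] := eqVneq (tsize (emb x)) j.
      by rewrite n0j /=; lra.
    by rewrite andbF; lra.
  rewrite Rpow_mult_distr; apply: Rmult_le_compat_r; [exact: pow_le | exact: few].
rewrite big_pred0; first by apply: pow_le; nra.
move=> x; apply/negbTE/negP => /andP[n0x /eqP xj].
by move: jn0; rewrite -xj szE ltnNge n0x.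
Qed.

(* Otherwise, for z slightly above the critical weight, the trees with at least
   n0 nodes would contribute at most a geometric series to gf z, which would
   then be bounded. *)
Lemma exists_many_trees (c : R) (n0 : nat) : c < ln growth ->
  exists n d, (n0 <= n)%N /\
    exp c ^ n <= INR #|[pred x : htree t d | tsize (emb x) == n]|.
Proof.
move=> cg; apply: NNPP => few.
have {}few n d : (n0 <= n)%N ->
    INR #|[pred x : htree t d | tsize (emb x) == n]| <= exp c ^ n.
  by move=> n0n; apply: Rnot_lt_le => lt; apply: few; exists n, d; split=> //; lra.
have L0 := growth_gt0; set L := growth in cg L0 *.
(* The geometric mean of [exp (- c)] and [/ L], strictly between the two. *)
pose z := exp (- ((c + ln L) / 2)).
have z0 : 0 < z := exp_pos _.
have zL : / L < z.
  by rewrite -[L]exp_ln // -exp_Ropp; apply: exp_increasing; lra.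
have cz : exp c * z < 1.
  by rewrite -exp_plus -exp_0; apply: exp_increasing; lra.
have zL1 : 1 <= z * L.
  by apply: (Rmult_le_reg_r (/ L)); [exact: Rinv_0_lt_compat | field_simplify; lra].
(* The first term bounds the trees with fewer than [n0] nodes, by [z ^ n <= (z L) ^ n0 / L ^ n] and
   the critical bound 2; the second is the geometric series. *)
pose K := (z * L) ^ n0 * 2 + / (1 - exp c * z).
have [d Hd] := INR_unbounded (K / (z - / L)).
have lb : K < gf z d.
  apply: Rlt_le_trans (gf_ge d (Rlt_le _ _ zL)).
  rewrite -/L; suff : K < INR d * (z - / L) by lra.
  apply: (Rmult_lt_reg_r (/ (z - / L))); first by apply: Rinv_0_lt_compat; lra.
  rewrite Rmult_assoc Rinv_r; [rewrite Rmult_1_r; exact: Hd | lra].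
suff : gf z d <= K by lra.
rewrite /gf (bigID (fun x => n0 <= tsize (emb x))%N) /= Rplus_comm.
apply: Rplus_le_compat; last first.
  by apply: rsum_tsize_geom => //; [lra | move=> n; apply: few].
apply: (Rle_trans _ ((z * L) ^ n0 * gf (/ L) d)); last first.
  by apply: Rmult_le_compat_l (gf_growth_le2 d); apply: pow_le; lra.
rewrite /gf big_distrr big_mkcond; apply: rsum_le => x _ /=.
have p1 : 0 <= (/ L) ^ tsize (emb x) by apply/pow_le/Rlt_le/Rinv_0_lt_compat.
have p2 : 0 <= (z * L) ^ n0 by apply: pow_le; lra.
case: leqP => [_|lt] /=; first exact: Rmult_le_pos.
have {1}-> : z = (z * L) * / L by field; lra.
rewrite Rpow_mult_distr; apply: Rmult_le_compat_r => //.
by apply: Rle_pow => //; apply/leP/ltnW.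
Qed.

End GeneratingFunction.

Local Open Scope nat_scope.

(** * Padding trees and large families of trees *)

Section LowerBound.
Variables (t : nat) (ht : 2 <= t).
Implicit Types T a b : ttree t.

Definition node2 a b : ttree t :=
  TNode [ffun i : 'I_t => if val i is i'.+1 then if i' is 0 then b else TEmpty else a].

Lemma sum_node2 (F : ttree t -> nat) a b : F TEmpty = 0 ->
  \sum_(i < t) F (if val i is i'.+1 then if i' is 0 then b else TEmpty else a)
    = F a + F b.
Proof.
case: t ht F a b => [|[|t']] // _ F a b F0.
by rewrite !big_ord_recl /= big1 // addn0.
Qed.

Lemma tsize_node2 a b : tsize (node2 a b) = (tsize a + tsize b).+1.
Proof.
by rewrite tsize_node -[in RHS]sum_node2 //; congr _.+1; apply: eq_bigr => i _; rewrite ffunE.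
Qed.

Lemma tpathlen_node2 a b :
  tpathlen (node2 a b) = tpathlen a + tsize a + (tpathlen b + tsize b).
Proof.
rewrite tpathlen_node -(sum_node2 (F := fun T => tpathlen T + tsize T)) //.
by apply: eq_bigr => i _; rewrite ffunE.
Qed.

Lemma node2_inj a b a' b' : node2 a b = node2 a' b' -> a = a' /\ b = b'.
Proof.
case=> /ffunP E; split.
  by have := E (Ordinal (ltnW ht)); rewrite !ffunE.
by have := E (Ordinal ht); rewrite !ffunE.
Qed.

(* The sum of the depths of the nodes of T when its root is at depth k. *)
Definition weight k T := tpathlen T + k * tsize T.

Lemma weight_node2 k a b :
  weight k (node2 a b) = weight k.+1 a + weight k.+1 b + k.
Proof. by rewrite /weight tsize_node2 tpathlen_node2; lia. Qed.

Lemma sum_consecutive n k : 2 * (\sum_(i < n) (k + i)) + n = n * (2 * k + n).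
Proof.
elim: n => [|n IH]; first by rewrite big_ord0.
by rewrite big_ord_recr /=; move: IH; set S := \sum_(i < n) _; nia.
Qed.

(* A path of n nodes with root at depth k, and one extra leaf at depth e. *)
Lemma spine_weight n k e : e = 0 \/ k < e <= k + n ->
  exists T, weight k T = \sum_(i < n) (k + i) + e.
Proof.
elim: n k e => [|n IH] k e he.
  exists TEmpty; rewrite big_ord0 /weight /= muln0; case: he => [->|] //; lia.
have sumE : \sum_(i < n.+1) (k + i) = k + \sum_(i < n) (k.+1 + i).
  by rewrite big_ord_recl addn0; congr (_ + _); apply: eq_bigr => i _; rewrite lift0 addSnnS.
(* A leaf at depth [k + 1] becomes the second child of the root; otherwise [e] is passed on to the
   rest of the path. The value [e = 0] means no extra leaf. *)
have [ek|ek] := eqVneq e k.+1.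
  have [T HT] := IH k.+1 0 (or_introl erefl).
  exists (node2 T (node2 TEmpty TEmpty)); rewrite !weight_node2 HT sumE ek /weight /=; lia.
have [|T HT] := IH k.+1 e; first by case: he; lia.
by exists (node2 T TEmpty); rewrite weight_node2 HT sumE /weight /=; lia.
Qed.

Lemma triangular_decomposition r : exists n e, r = \sum_(i < n) (1 + i) + e /\ e <= n.
Proof.
elim: r => [|r [n [e [-> en]]]]; first by exists 0, 0; rewrite big_ord0.
have [lt|ge] := ltnP e n; first by exists n, e.+1; rewrite addnS.
by exists n.+1, 0; rewrite big_ord_recr /=; split=> //; lia.
Qed.

(* A path with n nodes and at most one extra leaf misses only the remainder
   e = 1, for which a path with n - 1 nodes and two extra leaves is used. *)
Lemma exists_weight1 r : 10 <= r -> exists T, weight 1 T = r.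
Proof.
have [n [e [-> en]]] := triangular_decomposition r => r10.
have [e1|e1] := eqVneq e 1; last by apply: spine_weight; lia.
have sE := sum_consecutive n 1; case: n => [|[|[|[|n]]]] in en r10 sE *; try lia.
(* The dropped node at depth [n + 4] and the remainder 1 are made up by leaves at depths [n + 3] and
   2. *)
have [|T HT] := @spine_weight n.+2 2 n.+3; first by lia.
exists (node2 T (node2 TEmpty TEmpty)).
have := sum_consecutive n.+2 2; rewrite !weight_node2 HT e1 /weight /=.
move: sE; set S := \sum_(i < n.+4) _; set S' := \sum_(i < n.+2) _; nia.
Qed.

(** The size bound is strict so that it absorbs a new root: [t] trees of size below [s] under a root
    have size below [t * s]. *)
Definition many_trees (N s w : nat) : Prop :=
  exists (X : finType) (f : X -> ttree t),
    [/\ injective f, N <= #|X| & forall x, tsize (f x) < s /\ tpathlen (f x) <= w].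

Lemma many_trees_card d n :
  many_trees #|[pred x : htree t d | tsize (emb x) == n]| n.+1 (n ^ 2).
Proof.
exists {x : htree t d | tsize (emb x) == n}, (fun x => emb (val x)); split.
- by move=> x y /emb_inj /val_inj.
- by rewrite card_sig.
- by move=> [x /= /eqP <-]; split=> //; apply: tpathlen_le_sqr.
Qed.

(** Hanging [q] independently chosen trees along a path turns blocks of one fixed size into trees of
    growing size with the same exponential rate. *)
Lemma many_trees_chain N s w q : many_trees N s w ->
  many_trees (N ^ q) (q * s).+1 ((q * s) ^ 2).
Proof.
case=> X [f [f_inj NX fP]].
suff [Y [g [g_inj NY gP]]] : exists (Y : finType) (g : Y -> ttree t),
    [/\ injective g, N ^ q <= #|Y| & forall y, tsize (g y) <= q * s].
  exists Y, g; split=> // y; split; first exact: gP.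
  by apply: leq_trans (tpathlen_le_sqr _) _; rewrite leq_sqr.
elim: q => [|q [Y [g [g_inj NY gP]]]].
  by exists unit, (fun=> TEmpty); split=> // [[] []|]; rewrite ?card_unit.
exists (X * Y)%type, (fun xy => node2 (f xy.1) (g xy.2)); split.
- by move=> [x y] [x' y'] /node2_inj [/f_inj /= -> /g_inj /= ->].
- by rewrite card_prod expnS leq_mul.
- by move=> [x y]; rewrite tsize_node2 mulSn /=; have := fP x; have := gP y; lia.
Qed.

Lemma many_trees_node N s w : many_trees N s w ->
  many_trees (N ^ t) (t * s) (t * (w + s)).
Proof.
case=> X [f [f_inj NX fP]].
exists {ffun 'I_t -> X}, (fun g : {ffun 'I_t -> X} => TNode [ffun i => f (g i)]); split.
- move=> g h [/ffunP E]; apply/ffunP => i; apply: f_inj.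
  by move: (E i); rewrite !ffunE.
- by rewrite card_ffun card_ord leq_exp2r // ltnW.
move=> g; rewrite tsize_node tpathlen_node.
have s_gt0 : 0 < s.
  by have := fP (g (Ordinal ht)); lia.
have szle : \sum_i tsize ([ffun i => f (g i)] i) <= t * s.-1.
  rewrite -[t in _ <= t * _]card_ord -sum_nat_const; apply: leq_sum => i _.
  by rewrite ffunE; have := fP (g i); lia.
split; first by move: szle; set S := \sum_i _; nia.
rewrite -[t in _ <= t * _]card_ord -sum_nat_const; apply: leq_sum => i _.
by rewrite !ffunE; case: (fP (g i)) => /ltnW lt_s le_w; apply: leq_add.
Qed.

(** Each level of the complete tree pushes all slot trees down by one, whence [D * s] per slot. *)
Lemma many_trees_complete N s w D : many_trees N s w ->
  many_trees (N ^ (t ^ D)) (t ^ D * s) (t ^ D * (w + D * s)).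
Proof.
move=> NP; elim: D => [|D /many_trees_node].
  by rewrite !mul1n mul0n addn0 expn1.
have -> : (N ^ t ^ D) ^ t = N ^ t ^ D.+1 by rewrite -expnM expnSr.
have -> : t * (t ^ D * s) = t ^ D.+1 * s by rewrite expnS mulnA.
by have -> : t * (t ^ D * (w + D * s) + t ^ D * s) = t ^ D.+1 * (w + D.+1 * s)
  by rewrite expnS; lia.
Qed.

(** At depth 1 each tree of the family weighs less than [w + s], so the margin 10 makes a padding
    tree available. Injectivity is read off the first child. *)
Lemma Tcount_ge_many N s w p : many_trees N s w -> w + s + 10 <= p ->
  N <= Tcount t p.
Proof.
case=> X [f [f_inj NX fP]] le_p; apply: leq_trans NX _.
have /fin_all_exists [g Hg] x : exists T, weight 1 T = p - weight 1 (f x).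
  by apply: exists_weight1; have := fP x; rewrite /weight; lia.
apply: (Tcount_ge (f := fun x => node2 (f x) (g x))).
  by move=> x y /node2_inj [/f_inj].
move=> x; rewrite /has_pathlen tsize_node2 tpathlen_node2 ltn0Sn /=.
by apply/eqP; have := Hg x; have := fP x; rewrite /weight; lia.
Qed.

Lemma Tcount_ge_complete d n q D p :
  t ^ D * ((q * n.+1) ^ 2 + D.+1 * (q * n.+1).+1) + 10 <= p ->
  #|[pred x : htree t d | tsize (emb x) == n]| ^ (q * t ^ D) <= Tcount t p.
Proof.
move=> le_p; rewrite expnM.
apply: Tcount_ge_many (many_trees_complete D _) _.
  exact: many_trees_chain q (many_trees_card d n).
apply: leq_trans le_p; rewrite leq_add2r -mulnDr -addnA leq_mul2l.
by rewrite [D.+1 * _]mulSn [_ + D * _]addnC leqnn orbT.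
Qed.

End LowerBound.

Local Open Scope R_scope.

Lemma INR_expn m n : INR (m ^ n)%N = INR m ^ n.
Proof. by elim: n => [|n IH] //; rewrite expnS mult_INR IH. Qed.

(** * Upper bound on the count from the critical generating function *)

Section UpperBound.
Variables (t : nat) (ht : (2 <= t)%N).

Lemma growth_gt1 : 1 < growth t.
Proof.
have INRt : 2 <= INR t by apply: (le_INR 2); apply/leP.
have p0 : 0 < (INR t - 1) ^ t.-1 by apply: pow_lt; lra.
have ple : (INR t - 1) ^ t.-1 <= INR t ^ t.-1 by apply: pow_incr; lra.
apply: (Rmult_lt_reg_r ((INR t - 1) ^ t.-1)) => //.
rewrite /growth /Rdiv Rmult_assoc Rinv_l; last lra.
have -> : INR t ^ t = INR t * INR t ^ t.-1 by rewrite tech_pow_Rmult prednK // ltnW.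
nra.
Qed.

Lemma ln_growth : ln (growth t) = INR t * ln (INR t) - (INR t - 1) * ln (INR t - 1).
Proof.
have INRt : 2 <= INR t by apply: (le_INR 2); apply/leP.
rewrite /growth /Rdiv ln_mult;
  try by [apply: pow_lt; lra | apply/Rinv_0_lt_compat/pow_lt; lra].
rewrite ln_Rinv; last by apply: pow_lt; lra.
rewrite !ln_pow; [|lra..].
have -> : INR t.-1 = INR t - 1 by rewrite -{2}(prednK (ltnW ht)) S_INR; lra.
lra.
Qed.

(** Each tree counted has at most [N] nodes, so it contributes at least [growth ^ (- N)] to the
    generating function at the critical weight, which is at most 2. *)
Lemma Tcount_le p k N : (0 < k)%N ->
  INR p + 2 * INR t ^ k <= INR k * N ->
  INR (Tcount t p) <= 2 * Rpower (growth t) N.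
Proof.
move=> k_gt0 leN; have g1 := growth_gt1; have g0 : 0 < growth t by lra.
have k0 : 0 < INR k by apply: lt_0_INR; apply/ltP.
apply: (Rmult_le_reg_r (Rpower (growth t) (- N))); first exact: exp_pos.
rewrite Rmult_assoc -Rpower_plus Rplus_opp_r Rpower_O // Rmult_1_r.
apply: Rle_trans (gf_growth_le2 ht p.+1); rewrite TcountE.
rewrite -rsum_const big_mkcond; apply: rsum_le => x _ /=.
have gx : (/ growth t) ^ tsize (emb x) = Rpower (growth t) (- INR (tsize (emb x))).
  by rewrite Rpower_Ropp Rpower_pow // pow_inv.
rewrite gx; case: ifP => [/andP[_ /eqP px]|_]; last exact/Rlt_le/exp_pos.
apply: Rle_Rpower; first lra; apply: Ropp_le_contravar.
apply: (Rmult_le_reg_l (INR k)) => //; apply: Rle_trans leN.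
have /leP/le_INR := mul_tsize_le (emb x) k ht.
by rewrite px plus_INR !mult_INR INR_expn.
Qed.
End UpperBound.

Lemma exp_pow a n : exp a ^ n = exp (a * INR n).
Proof.
elim: n => [|n IH]; first by rewrite /= Rmult_0_r exp_0.
by rewrite -tech_pow_Rmult IH S_INR -exp_plus; congr exp; ring.
Qed.

Lemma exp_le a c : a <= c -> exp a <= exp c.
Proof. by case=> [/exp_increasing/Rlt_le //|->]; apply: Rle_refl. Qed.

Lemma ln_le a c : 0 < a -> a <= c -> ln a <= ln c.
Proof. by move=> a0 [/(ln_increasing _ _ a0)/Rlt_le //|->]; apply: Rle_refl. Qed.

(** * Choice of parameters and asymptotic bounds *)

Section Asymptotics.
Variables (t : nat) (ht : (2 <= t)%N).

Let INRt : 2 <= INR t.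
Proof. by apply: (le_INR 2); apply/leP. Qed.

Let lnt_gt0 : 0 < ln (INR t).
Proof. by rewrite -ln_1; apply: ln_increasing; lra. Qed.

Lemma step_bracket (f : nat -> R) v : f 0%N <= v -> (exists m, v < f m) ->
  exists k, f k <= v < f k.+1.
Proof.
move=> f0 [m]; elim: m => [|m IH] lt; first lra.
by case: (Rlt_le_dec v (f m)) => [/IH //|le]; exists m.
Qed.

Lemma pow_bracket v : 1 <= v -> exists k, INR t ^ k <= v < INR t ^ k.+1.
Proof.
move=> v1; apply: step_bracket => //.
have [m Hm] := INR_unbounded v; exists m.
by have := bernoulli_ge0 m (u := INR t) ltac:(lra); have := pos_INR m; nra.
Qed.

(* In terms of s = sqrt (ln p), all the error terms are powers of s. *)
Lemma large_sqrt_ln (s0 : R) : exists p0, forall p, (p0 <= p)%N ->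
  exists2 s, s0 <= s & INR p = exp (s ^ 2).
Proof.
have [p0 Hp0] := INR_unbounded (exp (Rabs s0 ^ 2)); exists p0 => p /leP /le_INR le_p.
have p_gt : exp (Rabs s0 ^ 2) < INR p by lra.
have p_gt0 : 0 < INR p by have := exp_pos (Rabs s0 ^ 2); lra.
have lnp : Rabs s0 ^ 2 < ln (INR p).
  by rewrite -[X in X < _]ln_exp; apply: ln_increasing => //; apply: exp_pos.
have a0 := Rabs_pos s0; have lnp0 : 0 <= ln (INR p) by nra.
exists (sqrt (ln (INR p))); last by rewrite pow2_sqrt // exp_ln.
apply: Rle_trans (Rle_abs s0) _; rewrite -(sqrt_pow2 _ a0).
by apply: sqrt_le_1_alt; lra.
Qed.

Lemma ln_le_id s : 0 < s -> ln s <= s.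
Proof. by move=> s0; have := exp_ineq1_le (ln s); rewrite exp_ln //; lra. Qed.

Lemma exp_sqr_ge s : s ^ 4 <= 4 * exp (s ^ 2).
Proof.
have -> : exp (s ^ 2) = exp (s ^ 2 / 2) * exp (s ^ 2 / 2).
  by rewrite -exp_plus; congr exp; lra.
by have := exp_ineq1_le (s ^ 2 / 2); nra.
Qed.

Lemma Tcount_upper eta : 0 < eta <= / 2 -> exists p0, forall p, (p0 <= p)%N ->
  INR (Tcount t p) <=
    exp ((1 + 5 * eta) * (ln (growth t) * ln (INR t) * INR p / ln (INR p))).
Proof.
move=> eta01; set c := ln (growth t); set l := ln (INR t).
have c0 : 0 < c by rewrite /c -ln_1; apply: ln_increasing; [lra | exact: growth_gt1].
have [p0 Hp0] := large_sqrt_ln (4 + (2 + l) / eta + 2 / eta + 4 / (eta * c * l)).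
exists p0 => p /Hp0 [s s_ge pE]; rewrite pE ln_exp.
have div_pos a : 0 < a -> 0 < a / eta by move=> a0; apply: Rdiv_lt_0_compat; lra.
have ecl : 0 < eta * c * l by apply: Rmult_lt_0_compat => //; nra.
have q1 : 0 < (2 + l) / eta by apply: div_pos; rewrite /l; lra.
have q2 : 0 < 2 / eta by apply: div_pos; lra.
have q3 : 0 < 4 / (eta * c * l) by apply: Rdiv_lt_0_compat; lra.
have s4 : 4 <= s by lra.
have es : 2 + l <= eta * s.
  have -> : 2 + l = eta * ((2 + l) / eta) by field; lra.
  by apply: Rmult_le_compat_l; lra.
have ecls : 4 <= eta * c * l * s.
  have {1}-> : 4 = eta * c * l * (4 / (eta * c * l)).
    by field; do ?split; rewrite /l; lra.
  by apply: Rmult_le_compat_l; lra.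
have l0 : 0 < l := lnt_gt0.
have := exp_sqr_ge s; set P := exp (s ^ 2) => P_ge.
have P0 : 0 < P := exp_pos _.
have s2 : 16 <= s ^ 2 by nra.
have s4E : s ^ 4 = s ^ 2 * s ^ 2 by ring.
have s2P : s ^ 2 <= P by nra.
have y1 : 1 <= P / s ^ 2.
  by apply: (Rmult_le_reg_r (s ^ 2)); [lra | field_simplify; lra].
have [k [k_le k_lt]] := pow_bracket y1.
have tk0 : 0 < INR t ^ k.+1 by apply: pow_lt; lra.
(* Taking logarithms in [k_lt] loses [2 ln s + l], which [eta s ^ 2] covers. *)
have kl : (1 - eta) * s ^ 2 < INR k * l.
  have : ln (P / s ^ 2) < ln (INR t ^ k.+1) by apply: ln_increasing; lra.
  rewrite ln_pow; last lra.
  rewrite ln_mult // ?ln_Rinv; [|lra|by apply: Rinv_0_lt_compat; lra].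
  rewrite ln_exp ln_pow; last lra.
  have -> : INR 2 = 2 by [].
  rewrite S_INR -/l; have := @ln_le_id s ltac:(lra) => lns.
  by nra.
have k0 : (0 < k)%N.
  by case: (k) kl => //=; nra.
(* The quotient of the bound [(1 + eta) P] on [p + 2 t ^ k] by the lower bound [(1 - eta) s ^ 2 / l]
   on [k]. *)
pose N := P * (1 + eta) * l / ((1 - eta) * s ^ 2).
have [e0 e1] : 0 < eta /\ 0 < 1 - eta by lra.
have den0 : 0 < (1 - eta) * s ^ 2 by apply: Rmult_lt_0_compat; lra.
apply: Rle_trans (Tcount_le (N := N) ht k0 _) _.
  rewrite pE -/P; apply: (Rle_trans _ (P * (1 + eta))).
    have -> : P * (1 + eta) = P + eta * s ^ 2 * (P / s ^ 2) by field; lra.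
    have e2 : 2 <= eta * s ^ 2 by nra.
    have := Rmult_le_compat_r (P / s ^ 2) _ _ ltac:(lra) e2; lra.
  have -> : INR k * N = P * (1 + eta) * (INR k * l / ((1 - eta) * s ^ 2)).
    by rewrite /N; field; lra.
  rewrite -{1}[P * (1 + eta)]Rmult_1_r; apply: Rmult_le_compat_l; first by nra.
  apply: (Rmult_le_reg_r ((1 - eta) * s ^ 2)) => //.
  by rewrite /Rdiv Rmult_assoc Rinv_l; lra.
have le2 : 2 <= exp 1 by have := exp_ineq1_le 1; lra.
apply: (Rle_trans _ (exp (1 + N * c))).
  by rewrite exp_plus; apply: Rmult_le_compat_r le2; apply/Rlt_le/exp_pos.
set B := c * l * P / s ^ 2.
(* The ratio [(1 + eta) / (1 - eta)] costs [4 eta]; the fifth [eta] absorbs the factor 2. *)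
have eB : 1 <= eta * B.
  apply: (Rmult_le_reg_r (s ^ 2)); first lra.
  have -> : eta * B * s ^ 2 = eta * c * l * P by rewrite /B; field; lra.
  have : eta * c * l * s ^ 4 <= eta * c * l * (4 * P) by apply: Rmult_le_compat_l; lra.
  have : 4 * s ^ 3 <= eta * c * l * s * s ^ 3.
    by apply: Rmult_le_compat_r => //; apply: pow_le; lra.
  by nra.
have B0 : 0 < B by nra.
have -> : N * c = (1 + eta) / (1 - eta) * B by rewrite /N /B; field; lra.
have r_le : (1 + eta) / (1 - eta) <= 1 + 4 * eta.
  by apply: (Rmult_le_reg_r (1 - eta)) => //; rewrite /Rdiv Rmult_assoc Rinv_l; nra.
have := Rmult_le_compat_r B _ _ (Rlt_le _ _ B0) r_le => rB.
by apply: exp_le; lra.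
Qed.

(* D is chosen with t ^ D close to p / (ln p) ^ (3/2), so that q is of order
   sqrt (ln p): large, but small compared with D. *)
Lemma exists_depth_blocks (n1 : nat) eta : (0 < n1)%N -> 0 < eta < 1 ->
  exists p0, forall p, (p0 <= p)%N -> exists D q,
    (t ^ D * ((q * n1) ^ 2 + D.+1 * (q * n1).+1) + 10 <= p)%N /\
    (1 - 2 * eta) * (ln (INR t) * INR p / ln (INR p)) <= INR (n1 * q * t ^ D).
Proof.
move=> n1_gt0 eta01; have := lnt_gt0; set l := ln (INR t) => l0.
set tau := INR t; have tau2 : 2 <= tau := INRt.
have n1R : 1 <= INR n1 by apply: (le_INR 1); apply/leP.
pose s1 := 4 * (tau * l ^ 2) / eta.
pose s2 := 4 * l / eta.
pose s3 := 4 * (/ l + 11) / eta.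
pose s4 := INR n1 / (eta * l).
have lV : 0 < / l by apply: Rinv_0_lt_compat.
have tl0 : 0 < tau * l ^ 2 by apply: Rmult_lt_0_compat; [lra | apply: pow_lt].
have el0 : 0 < eta * l by apply: Rmult_lt_0_compat; lra.
have s1_gt0 : 0 < s1 by apply: Rdiv_lt_0_compat; lra.
have s2_gt0 : 0 < s2 by apply: Rdiv_lt_0_compat; lra.
have s3_gt0 : 0 < s3 by apply: Rdiv_lt_0_compat; lra.
have s4_gt0 : 0 < s4 by apply: Rdiv_lt_0_compat; lra.
have [p0 Hp0] := large_sqrt_ln (4 + s1 + s2 + s3 + s4).
exists p0 => p /Hp0 [s s_ge pE]; rewrite pE ln_exp.
have s_ge4 : 4 <= s by lra.
have es1 : 4 * (tau * l ^ 2) <= eta * s.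
  have -> : 4 * (tau * l ^ 2) = eta * s1 by rewrite /s1; field; lra.
  by apply: Rmult_le_compat_l; lra.
have es2 : 4 * l <= eta * s.
  have -> : 4 * l = eta * s2 by rewrite /s2; field; lra.
  by apply: Rmult_le_compat_l; lra.
have es3 : 4 * (/ l + 11) <= eta * s.
  have -> : 4 * (/ l + 11) = eta * s3 by rewrite /s3; field; lra.
  by apply: Rmult_le_compat_l; lra.
have es4 : INR n1 <= eta * l * s.
  have -> : INR n1 = eta * l * s4 by rewrite /s4; field; lra.
  by apply: Rmult_le_compat_l; lra.
have := exp_sqr_ge s; set P := exp (s ^ 2) => P_ge.
have P0 : 0 < P := exp_pos _.
have s3pos : 0 < s ^ 3 by apply: pow_lt; lra.
have s2pos : 16 <= s ^ 2 by nra.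
have y1 : 1 <= P / s ^ 3.
  by apply: (Rmult_le_reg_r (s ^ 3)) => //; field_simplify; nra.
have [D [D_le D_lt]] := pow_bracket y1; rewrite -/tau in D_le D_lt.
have tD1 : 1 <= tau ^ D by apply: pow_R1_Rle; lra.
(* The share of the path length available to each of the [t ^ D] slots, of order [s ^ 3]. *)
pose Y := P / tau ^ D.
have PE : P = Y * tau ^ D by rewrite /Y; field; lra.
have Y_ge : s ^ 3 <= Y.
  apply: (Rmult_le_reg_r (tau ^ D)); first lra.
  rewrite -PE.
  have {1}-> : P = s ^ 3 * (P / s ^ 3) by field; lra.
  by apply: Rmult_le_compat_l; lra.
have Y_lt : Y < tau * s ^ 3.
  apply: (Rmult_lt_reg_r (tau ^ D)); first lra.
  rewrite -PE; have {1}-> : P = s ^ 3 * (P / s ^ 3) by field; lra.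
  have -> : tau * s ^ 3 * tau ^ D = s ^ 3 * tau ^ D.+1 by rewrite /=; ring.
  exact: Rmult_lt_compat_l.
have Y0 : 0 < Y by lra.
have Dl : INR D * l <= s ^ 2.
  rewrite -(ln_exp (s ^ 2)) -/P -ln_pow; last lra.
  apply: ln_le; first by apply: pow_lt; lra.
  apply: Rle_trans D_le _; apply: (Rmult_le_reg_r (s ^ 3)) => //.
  rewrite /Rdiv Rmult_assoc Rinv_l; last lra.
  by apply: Rmult_le_compat_l; [lra | apply: pow_R1_Rle; lra].
(* The target size of a slot tree: as [D <= s ^ 2 / l], depth [D] times size [W] uses at most
   [(1 - eta) Y]. *)
pose W := (1 - eta) * Y * l / s ^ 2.
have W0 : 0 <= W.
  by apply/Rlt_le/Rdiv_lt_0_compat; [apply: Rmult_lt_0_compat; nra | lra].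
have [q [q_le q_lt]] : exists q, INR (q * n1) <= W < INR (q.+1 * n1).
  apply: (@step_bracket (fun q => INR (q * n1))) => //.
  have [m Hm] := INR_unbounded W; exists m; rewrite mult_INR.
  by have := pos_INR m; nra.
set m := (q * n1)%N in q_le *.
have m0 := pos_INR m.
exists D, q; split.
  apply/leP/INR_le; rewrite -/m pE -/P.
  have -> : INR (t ^ D * (m ^ 2 + D.+1 * m.+1) + 10)
          = tau ^ D * (INR m ^ 2 + (INR D + 1) * (INR m + 1)) + 10.
    rewrite plus_INR mult_INR (plus_INR (m ^ 2)%N) (mult_INR D.+1) !INR_expn.
    rewrite (S_INR D) (S_INR m).
    by congr (_ + _); rewrite /=; lra.
  have m_le : INR m <= Y * l / s ^ 2.
    apply: Rle_trans q_le _; rewrite /W /Rdiv.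
    have v0 : 0 < / s ^ 2 by apply: Rinv_0_lt_compat; lra.
    apply: Rmult_le_compat_r; first lra.
    by apply: Rmult_le_compat_r; nra.
  have msq : INR m ^ 2 <= eta / 4 * Y.
    have m_le' : INR m <= tau * l * s.
      apply: Rle_trans m_le _; apply: (Rmult_le_reg_r (s ^ 2)); first lra.
      have -> : Y * l / s ^ 2 * s ^ 2 = Y * l by field; lra.
      have -> : tau * l * s * s ^ 2 = (tau * s ^ 3) * l by ring.
      by apply: Rmult_le_compat_r; lra.
    have tls : 0 < tau * l * s by apply: Rmult_lt_0_compat; nra.
    apply: (Rle_trans _ (tau * l * s * (Y * l / s ^ 2))).
      have -> : INR m ^ 2 = INR m * INR m by ring.
      exact: Rmult_le_compat.
    apply: (Rmult_le_reg_r s); first lra.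
    have -> : tau * l * s * (Y * l / s ^ 2) * s = (tau * l ^ 2) * Y by field; lra.
    have -> : eta / 4 * Y * s = (eta * s / 4) * Y by field.
    by apply: Rmult_le_compat_r; lra.
  have mY : INR m <= eta / 4 * Y.
    apply: Rle_trans m_le _; apply: (Rmult_le_reg_r (s ^ 2)); first lra.
    have -> : Y * l / s ^ 2 * s ^ 2 = l * Y by field; lra.
    have -> : eta / 4 * Y * s ^ 2 = (eta * s / 4 * s) * Y by field.
    by apply: Rmult_le_compat_r; nra.
  have D_le' : INR D <= s ^ 2 / l.
    by apply: (Rmult_le_reg_r l) => //; apply: Rle_trans Dl _; right; field; lra.
  have Dm : INR D * INR m <= (1 - eta) * Y.
    apply: Rle_trans (Rmult_le_compat _ _ _ _ (pos_INR D) m0 D_le' q_le) _.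
    by right; rewrite /W; field; lra.
  have D11 : INR D + 11 <= eta / 4 * Y.
    apply: (Rle_trans _ (eta / 4 * s ^ 3)); last by apply: Rmult_le_compat_l; lra.
    apply: (Rle_trans _ ((/ l + 11) * s ^ 2)); first by rewrite /Rdiv in D_le'; nra.
    have -> : eta / 4 * s ^ 3 = (eta * s / 4) * s ^ 2 by field.
    by apply: Rmult_le_compat_r; lra.
  have key : INR m ^ 2 + (INR D + 1) * (INR m + 1) + 10 <= Y.
    have -> : INR m ^ 2 + (INR D + 1) * (INR m + 1) + 10
            = INR m ^ 2 + INR D * INR m + INR m + (INR D + 11) by ring.
    lra.
  have := Rmult_le_compat_r (tau ^ D) _ _ ltac:(lra) key.
  rewrite -PE Rmult_plus_distr_r [_ * tau ^ D]Rmult_comm; lra.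
have -> : INR (n1 * q * t ^ D) = INR m * tau ^ D.
  by rewrite /m [(q * _)%N]mulnC mult_INR INR_expn.
(* Rounding down to whole blocks loses at most [n1], covered by the second [eta]. *)
have m_ge : W - INR n1 <= INR m.
  by move: q_lt; rewrite mulSn plus_INR -/m; lra.
have -> : (1 - 2 * eta) * (l * P / s ^ 2) = (W - eta * l * Y / s ^ 2) * tau ^ D.
  by rewrite /W PE; field; lra.
apply: Rmult_le_compat_r; first lra.
apply: Rle_trans m_ge; suff : INR n1 <= eta * l * Y / s ^ 2 by lra.
apply: Rle_trans es4 _; apply: (Rmult_le_reg_r (s ^ 2)); first lra.
have -> : eta * l * Y / s ^ 2 * s ^ 2 = eta * l * Y by field; lra.
have -> : eta * l * s * s ^ 2 = eta * l * s ^ 3 by ring.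
by apply: Rmult_le_compat_l; lra.
Qed.

Lemma Tcount_lower eta : 0 < eta < 1 -> exists p0, forall p, (p0 <= p)%N ->
  exp ((1 - 3 * eta) * (ln (growth t) * ln (INR t) * INR p / ln (INR p)))
    <= INR (Tcount t p).
Proof.
move=> eta01; have c0 : 0 < ln (growth t).
  by rewrite -ln_1; apply: ln_increasing; [lra | exact: growth_gt1].
have [n0 Hn0] := INR_unbounded (2 / eta).
have [|n [d [n0n HA]]] :=
  exists_many_trees (t := t) ht (c := (1 - eta / 2) * ln (growth t)) n0; first by nra.
set A := #|_| in HA.
have [p0 Hp0] := exists_depth_blocks (ltn0Sn n) eta01.
exists (maxn p0 2) => p; rewrite geq_max => /andP[/Hp0 [D [q [le_p le_m]]] p2].
have /leP/le_INR := Tcount_ge_complete ht d le_p.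
apply: Rle_trans; rewrite INR_expn.
(* A block of [n] nodes is charged [n + 1] by the chain; [n >= 2 / eta] makes this cost at most
   another [eta / 2]. *)
have le_n : (1 - eta) * ln (growth t) * INR n.+1 <= (1 - eta / 2) * ln (growth t) * INR n.
  have /leP/le_INR := n0n; rewrite S_INR => nn0.
  have en : 2 <= eta * INR n.
    by have -> : 2 = eta * (2 / eta) by [field; lra]; apply: Rmult_le_compat_l; lra.
  have := Rmult_le_compat_l _ _ _ (Rlt_le _ _ c0) en; nra.
have base : exp ((1 - eta) * ln (growth t) * INR n.+1) <= INR A.
  by apply: Rle_trans HA; rewrite exp_pow; apply: exp_le.
apply: Rle_trans (pow_incr _ _ _ (conj (Rlt_le _ _ (exp_pos _)) base)).
rewrite exp_pow; apply: exp_le.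
set B := ln (INR t) * INR p / ln (INR p) in le_m *.
have B0 : 0 < B.
  have p2' : 2 <= INR p by apply: (le_INR 2); apply/leP.
  apply: Rdiv_lt_0_compat; first nra.
  by rewrite -ln_1; apply: ln_increasing; lra.
have cB : 0 < ln (growth t) * B by apply: Rmult_lt_0_compat.
have -> : (1 - 3 * eta) * (ln (growth t) * ln (INR t) * INR p / ln (INR p))
        = (1 - 3 * eta) * (ln (growth t) * B) by rewrite /B /Rdiv; ring.
apply: (Rle_trans _ ((1 - eta) * ln (growth t) * ((1 - 2 * eta) * B))).
  have -> : (1 - eta) * ln (growth t) * ((1 - 2 * eta) * B)
          = ((1 - eta) * (1 - 2 * eta)) * (ln (growth t) * B) by ring.
  by apply: Rmult_le_compat_r; [lra | nra].
rewrite [X in _ <= X]Rmult_assoc -mult_INR multE mulnA.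
by apply: Rmult_le_compat_l le_m; nra.
Qed.

End Asymptotics.

(** * Change of base and passage to the limit *)

Theorem theorem1 (t : nat) (b : R) (ht : (2 <= t)%nat) (hb : 1 < b) :
  Un_cv (fun p : nat =>
           logb b (INR (Tcount t p)) / (alpha b t * INR p / logb b (INR p))) 1.
Proof.
have INRt : 2 <= INR t by apply: (le_INR 2); apply/leP.
have lnt : 0 < ln (INR t) by rewrite -ln_1; apply: ln_increasing; lra.
have lnb : 0 < ln b by rewrite -ln_1; apply: ln_increasing; lra.
have c0 : 0 < ln (growth t).
  by rewrite -ln_1; apply: ln_increasing; [lra | exact: growth_gt1].
(* Here [t h(1/t)] is the base [b] logarithm of [growth t]; the two factors [ln b] cancel in the
   final quotient. *)
have alphaE : alpha b t = ln (growth t) * ln (INR t) / (ln b * ln b).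
  rewrite /alpha /hent /logb ln_growth // ln_Rinv; last lra.
  have -> : 1 - / INR t = (INR t - 1) * / INR t by field; lra.
  rewrite ln_mult; [|lra|by apply: Rinv_0_lt_compat; lra].
  by rewrite ln_Rinv; [field; lra | lra].
move=> eps eps0.
(* The upper bound requires [eta <= / 2], and [eps / 10] keeps the larger error [5 eta] below
   [eps]. *)
pose eta := Rmin (/ 2) (eps / 10).
have eta01 : 0 < eta <= / 2.
  by split; [apply: Rmin_glb_lt; lra | exact: Rmin_l].
have eta_eps : 5 * eta < eps by have := Rmin_r (/ 2) (eps / 10); rewrite -/eta; lra.
have [p1 up] := Tcount_upper ht eta01.
have [|p2 low] := Tcount_lower ht (eta := eta); first lra.
exists (maxn 2 (maxn p1 p2)) => p /leP; rewrite !geq_max => /and3P[p_ge2 /up {}up /low {}low].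
have p2' : 2 <= INR p by apply: (le_INR 2); apply/leP.
have lnp : 0 < ln (INR p) by rewrite -ln_1; apply: ln_increasing; lra.
set a := ln (growth t) * ln (INR t) * INR p / ln (INR p) in up low.
have a0 : 0 < a.
  apply: Rdiv_lt_0_compat => //; apply: Rmult_lt_0_compat; last lra.
  exact: Rmult_lt_0_compat.
have T0 : 0 < INR (Tcount t p) by apply: Rlt_le_trans low; apply: exp_pos.
have {}up : ln (INR (Tcount t p)) <= (1 + 5 * eta) * a.
  by rewrite -[X in _ <= X]ln_exp; apply: ln_le.
have {}low : (1 - 3 * eta) * a <= ln (INR (Tcount t p)).
  by rewrite -[X in X <= _]ln_exp; apply: ln_le => //; apply: exp_pos.
have -> : logb b (INR (Tcount t p)) / (alpha b t * INR p / logb b (INR p))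
        = ln (INR (Tcount t p)) / a.
  by rewrite alphaE /a /logb; field; do ?split; lra.
have rE : ln (INR (Tcount t p)) = ln (INR (Tcount t p)) / a * a by field; lra.
move: up low; rewrite {1 2}rE; set r := _ / a => up low.
have ea : 0 <= eta * a by apply: Rmult_le_pos; lra.
rewrite /R_dist; apply: Rle_lt_trans eta_eps; apply: Rabs_le.
by split; apply: (Rmult_le_reg_r a); lra.
Qed.
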